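(* Let $I_1,I_2$ be sets of positive integers with $I_1\not\subseteq I_2$. Then (1) $\mathcal L^+_A(I_1)$ is exponentially more succinct than $\mathcal L^+_A(I_2)$, and (2) there is an $\mathcal L_A(I_1)$-formula for which there is no equivalent $\mathcal L_A(I_2)$-formula.
   Context: Bimodal Kripke models $M=(W,R_1,R_2,\Pi)$, pointed models $(M,w)$. For a word $s=s_1\dots s_l\in\{1,2\}^*$, $w'$ is an $s$-successor of $w$ if there are $w=w_0,\dots,w_l=w'$ with $(w_{k-1},w_k)\in R_{s_k}$. A language $L\subseteq\{1,2\}^*$ yields the modal operator $[L]$: $M,w\models[L]\varphi$ iff $M,w'\models\varphi$ for every $w'$ that is an $s$-successor of $w$ for some $s\in L$. For a set $\mathcal L$ of languages, $\mathcal L(\mathcal L)$ is the logic with formulas $\varphi::=p\mid\neg\varphi\mid\varphi\vee\varphi\mid[L]\varphi$ ($L\in\mathcal L$). For $\ell\ge1$, a word of length $\ell$ over $\{1,2\}$ is alternating if consecutive letters differ; $a^\ell_1$, $a^\ell_2$ denote the alternating words of length $\ell$ starting with $1$, resp. $2$, and $A_\ell=\{a^\ell_1,a^\ell_2\}$. For a set $I$ of positive integers, $\mathcal L_A(I)=\mathcal L(\{A_\ell:\ell\in I\})$ and $\mathcal L^+_A(I)=\mathcal L(\{A_\ell:\ell\in I\}\cup\{\{1\},\{2\}\})$. $|\varphi|$ is the number of nodes of the syntax tree; formulas are equivalent if they hold at the same pointed models. Logics $\mathcal L_1,\mathcal L_2$ are equally expressive if each formula of one has an equivalent formula in the other (all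 $\mathcal L^+_A(I)$ are equally expressive); then $\mathcal L_1$ is exponentially more succinct than $\mathcal L_2$ if there is a sequence $(\varphi_i)_{i\in\mathbb N}$ of $\mathcal L_1$-formulas with $|\varphi_i|$ linear in $i$ and a constant $c>1$ such that every $\mathcal L_2$-formula equivalent to $\varphi_i$ has size at least $c^i$. *)

(* Defs.v *)
From mathcomp Require Import all_boot all_order all_algebra.
From mathcomp Require Import boolp classical_sets reals Rstruct.
From Stdlib Require Rdefinitions.

Set Implicit Arguments.
Unset Strict Implicit.
Unset Printing Implicit Defensive.

Local Open Scope classical_set_scope.

Variant letter := L1 | L2.

Definition other (x : letter) : letter := if x is L1 then L2 else L1.

Definition word := seq letter.
Definition language := set word.

Record model := Model {
  world : Type;
  R1 : world -> world -> Prop;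
  R2 : world -> world -> Prop;
  valuation : nat -> set world
}.

Definition acc (M : model) (x : letter) : world M -> world M -> Prop :=
  if x is L1 then @R1 M else @R2 M.

Fixpoint successor (M : model) (s : word) (w w' : world M) : Prop :=
  if s is x :: s' then exists2 v, acc x w v & successor s' v w' else w = w'.

(* Formulas over all languages; a logic is the set of those formulas whose
   modal operators come from a prescribed set of languages. *)
Inductive formula :=
| Var of nat
| Neg of formula
| Or of formula & formula
| Box of language & formula.

Fixpoint sat (M : model) (w : world M) (phi : formula) : Prop :=
  match phi with
  | Var p => valuation p w
  | Neg phi1 => ~ sat w phi1
  | Or phi1 phi2 => sat w phi1 \/ sat w phi2
  | Box L phi1 => forall w', (exists2 s, L s & successor s w w') -> sat w' phi1
  end.

Definition equivalent (phi psi : formula) : Prop :=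
  forall (M : model) (w : world M), sat w phi <-> sat w psi.

Fixpoint fsize (phi : formula) : nat :=
  match phi with
  | Var _ => 1
  | Neg phi1 => (fsize phi1).+1
  | Or phi1 phi2 => (fsize phi1 + fsize phi2).+1
  | Box _ phi1 => (fsize phi1).+1
  end.

Fixpoint uses (Ls : set language) (phi : formula) : Prop :=
  match phi with
  | Var _ => True
  | Neg phi1 => uses Ls phi1
  | Or phi1 phi2 => uses Ls phi1 /\ uses Ls phi2
  | Box L phi1 => Ls L /\ uses Ls phi1
  end.

Definition logic (Ls : set language) : set formula := [set phi | uses Ls phi].

Fixpoint alt_word (x : letter) (l : nat) : word :=
  if l is l'.+1 then x :: alt_word (other x) l' else [::].

Definition alt_lang (l : nat) : language := [set alt_word L1 l; alt_word L2 l].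

Definition logicA (I : set nat) : set formula := logic [set alt_lang l | l in I].

Definition logicA_plus (I : set nat) : set formula :=
  logic ([set alt_lang l | l in I] `|` [set [set [:: L1]]; [set [:: L2]]]).

Definition equally_expressive (A B : set formula) : Prop :=
  (forall phi, A phi -> exists2 psi, B psi & equivalent phi psi) /\
  (forall psi, B psi -> exists2 phi, A phi & equivalent psi phi).

(* The notion is defined only between equally expressive logics, hence the
   first conjunct. *)
Definition exponentially_more_succinct (A B : set formula) : Prop :=
  equally_expressive A B /\
  exists phi : nat -> formula,
    [/\ forall i, A (phi i),
        exists a b : nat, forall i, fsize (phi i) <= a * i + b
      & exists2 c : Rdefinitions.R, (1 < c)%R &
          forall i psi, B psi -> equivalent psi (phi i) ->
            (c ^+ i <= (fsize psi)%:R)%R].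

(* Main.v *)
(* Fix [l] in [I1] but not in [I2].  The gadget of a bit [b] consists of two
   alternating words of length [l], the first starting with the letter of [b],
   whose junction repeats a letter.  For a sequence [bs] of [i] bits, the
   concatenation of the gadgets is a line of worlds that comes in a true and a
   false version, [p] holding only at the true end.  The true line may fall into
   the false one, and at the start of a gadget both lines may enter the true
   line through the wrong alternating word of length [k < l].  The formula
   [<A_l>^(2i) p] separates the two starting worlds, because a detour breaks an
   alternating block.  At the start of a gadget [A_k] cannot separate the lines:
   for [k < l] because of the detours, for [k > l] because of the repeated
   letter.  So at the start of a gadget a separating formula must commit to one
   letter, elsewhere the next letter is already known, and hence different
   sequences [bs] need different leaves of the formula. *)
From mathcomp Require Import all_boot all_order all_algebra.
From mathcomp Require Import boolp classical_sets reals Rstruct.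
From mathcomp Require Import zify.
Require Import Defs.

Set Implicit Arguments.
Unset Strict Implicit.
Unset Printing Implicit Defensive.

Import GRing.Theory Num.Theory.

(** * Alternating words *)

Lemma otherK : involutive other.
Proof. by case. Qed.

Lemma other_neq x : other x <> x.
Proof. by case: x. Qed.

Lemma iter_other_inj k : injective (iter k other).
Proof. by elim: k => [//|k IHk] x y /= /(can_inj otherK) /IHk. Qed.

Lemma size_alt_word x l : size (alt_word x l) = l.
Proof. by elim: l x => [//|l IHl] x /=; rewrite IHl. Qed.

Lemma alt_wordD x m n :
  alt_word x (m + n) = alt_word x m ++ alt_word (iter m other x) n.
Proof. by elim: m x => [//|m IHm] x; rewrite addSn /= IHm -iterSr. Qed.

Lemma cat_inj T (s1 s2 t1 t2 : seq T) :
  s1 ++ t1 = s2 ++ t2 -> size s1 = size s2 -> s1 = s2 /\ t1 = t2.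
Proof.
elim: s1 s2 => [|x s1 IHs] [|y s2] //= [-> e] [sz].
by have [-> ->] := IHs _ e sz.
Qed.

Lemma alt_word_inj x y l : 0 < l -> alt_word x l = alt_word y l -> x = y.
Proof. by case: l => // l _ []. Qed.

Lemma take_alt_word x k l : k <= l -> take k (alt_word x l) = alt_word x k.
Proof.
by move=> kl; rewrite -(subnKC kl) alt_wordD take_size_cat // size_alt_word.
Qed.

Lemma alt_langP k s : alt_lang k s -> exists x, s = alt_word x k.
Proof. by case=> ->; [exists L1 | exists L2]. Qed.

Lemma alt_lang_word x k : alt_lang k (alt_word x k).
Proof. by case: x; [left | right]. Qed.

(** * Gadgets and the two lines *)

Definition letter_of (b : bool) : letter := if b then L1 else L2.

Lemma letter_of_inj : injective letter_of.
Proof. by do 2 case. Qed.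

(** [iter l.-1 other] sends the first letter of a block to its last one, which the second block then
    repeats. *)
Definition gadget (l : nat) (b : bool) : word :=
  alt_word (letter_of b) l ++ alt_word (iter l.-1 other (letter_of b)) l.

Definition detour (l : nat) (b : bool) (k : nat) : word :=
  alt_word (other (letter_of b)) k ++ drop k (gadget l b).

(* What is left of the current gadget, and the bits of the gadgets after it. *)
Definition position := (word * seq bool)%type.

(** A gadget is opened only by its first step, so at its start the first component is still
    empty. *)
Definition main_step (l : nat) (x : letter) (q q' : position) : Prop :=
  (q.1 = x :: q'.1 /\ q.2 = q'.2) \/
  (q.1 = [::] /\ exists2 b, q.2 = b :: q'.2 & gadget l b = x :: q'.1).

Definition detour_step (l : nat) (x : letter) (q q' : position) : Prop :=
  q.1 = [::] /\
  exists b k, [/\ q.2 = b :: q'.2, 0 < k < l & detour l b k = x :: q'.1].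

(** The boolean is the version of the line. [w'.1 -> w.1] lets a main step fall to the false line
    but never climb back. *)
Definition edge (l : nat) (x : letter) (w w' : bool * position) : Prop :=
  (main_step l x w.2 w'.2 /\ (w'.1 -> w.1)) \/
  (detour_step l x w.2 w'.2 /\ w'.1).

Definition lines (l : nat) : model :=
  @Model (bool * position) (edge l L1) (edge l L2)
    (fun _ w => w = (true, ([::], [::]))).

Lemma acc_lines l x (w w' : world (lines l)) : acc x w w' <-> edge l x w w'.
Proof. by case: x. Qed.

Fixpoint main_path (l : nat) (s : word) (q q' : position) : Prop :=
  if s is x :: s' then exists2 q1, main_step l x q q1 & main_path l s' q1 q'
  else q = q'.

Lemma gadget_cons l b : 0 < l -> exists c, gadget l b = letter_of b :: c.
Proof. by case: l => // l _; rewrite /gadget /=; eexists. Qed.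

Lemma gadget_bit l b1 b2 x c1 c2 : 0 < l ->
  gadget l b1 = x :: c1 -> gadget l b2 = x :: c2 -> b1 = b2.
Proof.
move=> l0; have [d1 ->] := gadget_cons b1 l0; have [d2 ->] := gadget_cons b2 l0.
by case=> e1 _ [e2 _]; apply: letter_of_inj; rewrite e1 e2.
Qed.

Lemma size_gadget l b : size (gadget l b) = l + l.
Proof. by rewrite size_cat !size_alt_word. Qed.

Lemma take_gadget l b k :
  k <= l -> take k (gadget l b) = alt_word (letter_of b) k.
Proof.
move=> kl; rewrite take_cat size_alt_word; case: ltnP => [lt_kl|le_lk].
  exact: take_alt_word.
by have -> : k = l by [lia]; rewrite subnn take0 cats0.
Qed.

Lemma main_path_cat l s s' q q1 q' :
  main_path l s q q1 -> main_path l s' q1 q' -> main_path l (s ++ s') q q'.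
Proof.
elim: s q => [|x s IHs] q /=; first by move=> ->.
by case=> q2 st /IHs H /H {}H; exists q2.
Qed.

Lemma main_path_prefix l s s' q q' :
  main_path l (s ++ s') q q' -> exists q1, main_path l s q q1.
Proof.
elim: s q => [|x s IHs] q /=; first by exists q.
by case=> q1 st /IHs[q2 H]; exists q2, q1.
Qed.

Lemma main_path_line l s c bs : main_path l s (s ++ c, bs) (c, bs).
Proof.
by elim: s => [//|x s IHs] /=; exists (s ++ c, bs) => //; left.
Qed.

Lemma main_path_start l b bs s q : 0 < l -> s <> [::] ->
  main_path l s (gadget l b, bs) q <-> main_path l s ([::], b :: bs) q.
Proof.
move=> l0; case: s => // x s _; split=> /=.
  case=> -[c bs1]; case=> /= [[eg ebs] H|[eg [b' ebs eg']] H].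
    exists (c, bs1) => //; right; split=> //.
    by exists b => //=; rewrite ebs.
  by have [c' E] := gadget_cons b l0; rewrite E in eg.
case=> -[c bs1]; case=> /= [[]//|[_ [b' [eb ebs] eg]] H].
by exists (c, bs1) => //; left; rewrite eb ebs.
Qed.

Lemma main_path_inside l s c bs q : size s <= size c ->
  main_path l s (c, bs) q ->
  s = take (size s) c /\ q = (drop (size s) c, bs).
Proof.
elim: s c => [|x s IHs] c /= sz; first by move=> <-; rewrite take0 drop0.
case: c sz => // y c sz.
case=> -[c1 bs1]; case=> /= [[[-> <-] <-] H|[]//].
by have [e1 e2] := IHs _ sz H; rewrite /= -e1.
Qed.

(** Where a gadget starts, the letter read reveals its bit, so the bits need not be known in
    advance. *)
Lemma main_path_rest l v c bs1 bs2 q1 q2 : 0 < l ->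
  main_path l v (c, bs1) q1 -> main_path l v (c, bs2) q2 -> q1.1 = q2.1.
Proof.
move=> l0; elim: v c bs1 bs2 => [|x v IHv] c bs1 bs2 /=.
  by move=> <- <-.
case=> -[c1 d1] st1 H1 [[c2 d2] st2 H2].
suff e : c1 = c2 by rewrite e in H1; exact: IHv H1 H2.
case: st1 st2 => /= [[-> _]|[-> [b1 _ e1]]]; case=> /= [[]//|[]//].
- by case.
- move=> _ [b2 _ e2].
  by have eb := gadget_bit l0 e1 e2; move: e2; rewrite -eb e1 => -[].
Qed.

Lemma main_path_bits l v c bs1 bs2 : 0 < l ->
  main_path l v (c, bs1) ([::], [::]) -> main_path l v (c, bs2) ([::], [::]) ->
  bs1 = bs2.
Proof.
move=> l0; elim: v c bs1 bs2 => [|x v IHv] c bs1 bs2 /=.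
  by case=> _ -> [_ ->].
case=> -[c1 d1] st1 H1 [[c2 d2] st2 H2].
case: st1 st2 => /= [[-> ->]|[-> [b1 -> e1]]]; case=> /= [[]//|[]//].
- by case=> ec ->; apply: IHv H1 _; rewrite ec.
- move=> _ [b2 -> e2].
  have eb := gadget_bit l0 e1 e2; move: e2; rewrite -eb e1 => -[ec].
  by rewrite ec in H1; rewrite (IHv _ _ _ H1 H2).
Qed.

(** * Separating the two lines *)

Definition at_true l q : world (lines l) := (true, q).
Definition at_false l q : world (lines l) := (false, q).

Definition separates (l : nat) (phi : formula) (q : position) : Prop :=
  ~ (sat (at_true l q) phi <-> sat (at_false l q) phi).

Lemma successor_main l f s q q' : main_path l s q q' ->
  successor (M := lines l) s (f, q) (f, q').
Proof.
elim: s q => [|x s IHs] q /=; first by move=> ->.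
by case=> q1 st /IHs H; exists (f, q1) => //; apply/acc_lines; left.
Qed.

(** Every edge out of the false line has a copy out of the true one with the same target. *)
Lemma successor_true l s q w : s <> [::] ->
  successor s (at_false l q) w -> successor s (at_true l q) w.
Proof.
case: s => // x s _ /= [v /acc_lines e H]; exists v => //; apply/acc_lines.
by case: e => [[st _]|e]; [left | right].
Qed.

(** The false line can follow the same main steps up to the first fall or detour, where the two
    paths merge. *)
Lemma successor_false l s q w : successor s (at_true l q) w ->
  successor s (at_false l q) w \/
  exists2 q', main_path l s q q' & w = at_true l q'.
Proof.
elim: s q => [|x s IHs] q /=; first by move=> <-; right; exists q.
case=> -[f q1] /acc_lines e H.
case: e => [[/= st _]|[/= st ef]]; last first.
  by left; exists (f, q1) => //; apply/acc_lines; right.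
case: f H => H; last by left; exists (false, q1) => //; apply/acc_lines; left.
case: (IHs _ H) => [H'|[q' H' ew]].
  by left; exists (false, q1) => //; apply/acc_lines; left.
by right; exists q' => //; exists q1.
Qed.

(** By [successor_true] the box must fail at the true world and hold at the false one. A refuting
    successor is then out of reach of the false world, so it lies on the true line, and its false
    counterpart satisfies [phi]. *)
Lemma separates_Box l L phi q : (forall s, L s -> s <> [::]) ->
  separates l (Box L phi) q ->
  exists s q', [/\ L s, main_path l s q q', separates l phi q'
    & ~ (exists2 s', L s' & successor s' (at_false l q) (at_true l q'))].
Proof.
move=> Ln sep.
have tf : sat (at_true l q) (Box L phi) -> sat (at_false l q) (Box L phi).
  move=> H w [s Ls Hs]; apply: H; exists s => //.
  by apply: successor_true => //; exact: Ln.
have [Ht|Ht] := pselect (sat (at_true l q) (Box L phi)).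
  by exfalso; apply: sep; split=> // _; exact: tf.
have [Hf|Hf] := pselect (sat (at_false l q) (Box L phi)); last first.
  by exfalso; apply: sep; split.
move/existsNP: Ht => [w /not_implyP[[s Ls Hs] Nw]].
have [H|[q' Hq' ew]] := successor_false Hs.
  by case: Nw; apply: Hf; exists s.
exists s, q'; split=> //.
- move=> [_ H]; apply: Nw; rewrite ew; apply: H; apply: Hf; exists s => //.
  exact: successor_main.
- by case=> s' Ls' Hs'; apply: Nw; rewrite ew; apply: Hf; exists s'.
Qed.

Lemma separates_Neg l phi q : separates l (Neg phi) q -> separates l phi q.
Proof. by move=> H E; apply: H => /=; rewrite E. Qed.

Lemma separates_Or l phi psi q : separates l (Or phi psi) q ->
  separates l phi q \/ separates l psi q.
Proof.
move=> H; apply: contrapT => /not_orP[/contrapT E1 /contrapT E2].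
by apply: H => /=; rewrite E1 E2.
Qed.

Lemma separates_Var l n q : separates l (Var n) q -> q = ([::], [::]).
Proof. by move=> H; apply: contrapT => nq; apply: H; split=> -[]. Qed.

Lemma separates_start l k phi bs : 0 < k -> 0 < l -> k <> l ->
  ~ separates l (Box (alt_lang k) phi) ([::], bs).
Proof.
move=> k0 l0 kl sep.
have Ln s : alt_lang k s -> s <> [::].
  by case/alt_langP => x ->; case: k k0 {kl sep}.
case: (separates_Box Ln sep) => s [q' [Ls Hs _ Nd]].
have sn := Ln _ Ls.
case: bs sep Hs Nd => [|b bs] _ Hs Nd.
  by case: s sn Hs {Ls} => // x s _ [q1 [[]//|[_ []//]]].
have {}Hs := iffRL (main_path_start b bs q' l0 sn) Hs.
have [x es] := alt_langP Ls.
have [lt_kl|le_lk] := ltnP k l.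
  have sz : size s <= size (gadget l b).
    by rewrite es size_gadget size_alt_word; lia.
  have [_ eq'] := main_path_inside sz Hs.
  (* The detour of length [k] takes the false world to the true version of [q']. *)
  apply: Nd; exists (alt_word (other (letter_of b)) k).
    exact: alt_lang_word.
  rewrite eq' es size_alt_word.
  case: k k0 lt_kl {kl Ls Ln es Hs} => // k _ lt_kl /=.
  set u := alt_word _ k.
  exists (at_true l (u ++ drop k.+1 (gadget l b), bs)).
    by apply/acc_lines; right; split=> //; split=> //; exists b, k.+1.
  exact/successor_main/main_path_line.
(* A main path of more than [l] letters reads past the junction, where the gadget repeats a letter
   and an alternating word cannot. *)
have {le_lk kl} lt_lk : l.+1 <= k by lia.
move: Hs; rewrite es -(subnKC lt_lk) alt_wordD.
move=> /main_path_prefix[q1 /main_path_inside H].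
have [|e _] := H; first by rewrite size_gadget size_alt_word; lia.
move: e; rewrite size_alt_word.
rewrite -(addn1 l) alt_wordD take_cat size_alt_word.
have -> : (l + 1 < l) = false by lia.
rewrite addKn => /cat_inj; rewrite !size_alt_word => /(_ erefl)[e1 e2].
move: e2; rewrite take_alt_word // => -[].
rewrite (alt_word_inj l0 e1) -[in LHS](prednK l0) /=.
exact: other_neq.
Qed.

(** * Lower bounds *)

(** All sequences in [X] have read the same word [v]. A disjunction divides [X], a box extends [v]
    by one word for all of [X], and a variable separates only at the end, where [v] determines the
    sequence. *)
Lemma separating_size l i (I : set nat) phi v (X : {set i.-tuple bool}) :
  0 < l -> ~ I l -> (forall k, I k -> 0 < k) -> logicA_plus I phi ->
  (forall bs, bs \in X ->
     exists2 q, main_path l v ([::], val bs) q & separates l phi q) ->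
  #|X| <= fsize phi.
Proof.
move=> l0 Il I0; rewrite /logicA_plus /logic /=.
elim: phi v X => [n|phi IH|phi IH psi IH'|L phi IH] v X /=.
- move=> _ H; apply/card_le1_eqP => bs1 bs2 /H[q1 p1 /separates_Var e1].
  move=> /H[q2 p2 /separates_Var e2]; apply: val_inj.
  by subst; exact: main_path_bits l0 p2 p1.
- move=> U H; apply/leqW/(IH v) => // bs /H[q p /separates_Neg sep].
  by exists q.
- move=> [U1 U2] H.
  pose Y chi := [set bs in X |
    `[< exists2 q, main_path l v ([::], val bs) q & separates l chi q >]].
  have YE chi bs : bs \in Y chi ->
      exists2 q, main_path l v ([::], val bs) q & separates l chi q.
    by rewrite inE => /andP[_ /asboolP].
  have XY : X \subset Y phi :|: Y psi.
    apply/fintype.subsetP => bs bsX; have [q p /separates_Or sep] := H _ bsX.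
    by rewrite !inE bsX /=; apply/orP; case: sep => sep; [left|right];
      apply/asboolP; exists q.
  apply: leqW; apply: leq_trans (subset_leq_card XY) _.
  apply: leq_trans (leq_card_setU _ _) _.
  by apply: leq_add; [apply: (IH v) | apply: (IH' v)] => // bs /YE.
- move=> [UL U] H; apply: leqW.
  have [->|[bs0 bs0X]] := set_0Vmem X; first by rewrite cards0.
  suff [s Hs] : exists s, forall bs, bs \in X ->
      exists2 q, main_path l (v ++ s) ([::], val bs) q & separates l phi q.
    exact: IH Hs.
  case: UL => [[k Ik ek]|UL].
    have k0 := I0 _ Ik.
    have kl : k <> l by move=> e; apply: Il; rewrite -e.
    have Ln s : L s -> s <> [::].
      by rewrite -ek => /alt_langP[x ->]; case: k k0 {Ik ek kl}.
    (* What is left of the gadget is the same for all of [X], and nonempty by [separates_start]. Its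
       first letter [y] selects the alternating word. *)
    have [[c0 d0] p0 sep0] := H _ bs0X.
    case: c0 p0 sep0 => [|y c0] p0 sep0.
      by case: (separates_start (phi := phi) (bs := d0) k0 l0 kl); rewrite ek.
    exists (alt_word y k) => bs bsX.
    have [[c d] p sep] := H _ bsX.
    have /= ec := main_path_rest l0 p p0; rewrite {}ec in p sep.
    have [s [q' [Ls ps sep' _]]] := separates_Box Ln sep.
    exists q' => //; apply: main_path_cat p _.
    move: Ls; rewrite -ek => /alt_langP[x es].
    suff ey : y = x by rewrite [in alt_word y k]ey -es.
    move: ps; rewrite es; case: k k0 {Ik ek kl es} => // k _ /= [q1 st _].
    by case: st => /= [[[-> _] _]|[]].
  have [x ex] : exists x, L = (fun s => s = [:: x]).
    by case: UL => ->; [exists L1 | exists L2].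
  exists [:: x] => bs bsX; have [q p sep] := H _ bsX.
  have Ln s : L s -> s <> [::] by rewrite ex => ->.
  have [s [q' [Ls ps sep' _]]] := separates_Box Ln sep.
  by exists q' => //; apply: main_path_cat p _; move: Ls ps; rewrite ex => ->.
Qed.

(** Without one-letter boxes, every outermost box is evaluated at the start of a gadget, where it
    cannot separate. *)
Lemma not_separating l (I : set nat) phi b bs :
  0 < l -> ~ I l -> (forall k, I k -> 0 < k) -> logicA I phi ->
  ~ separates l phi ([::], b :: bs).
Proof.
move=> l0 Il I0; rewrite /logicA /logic /=.
elim: phi => [n|phi IH|phi IH psi IH'|L phi IH] /=.
- by move=> _ /separates_Var.
- by move=> U /separates_Neg; exact: IH.
- by move=> [U1 U2] /separates_Or[]; [exact: IH | exact: IH'].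
- move=> [[k Ik <-] U]; apply: separates_start => //; first exact: I0.
  by move=> e; apply: Il; rewrite -e.
Qed.

(** * The separating formulas *)

Fixpoint diamonds (l n : nat) : formula :=
  if n is n'.+1 then Neg (Box (alt_lang l) (Neg (diamonds l n'))) else Var 0.

Lemma sat_diamonds (M : model) (w : world M) l n :
  sat w (diamonds l n.+1) <->
  exists x w', successor (alt_word x l) w w' /\ sat w' (diamonds l n).
Proof.
split=> /=.
  move=> H; apply: contrapT => N; apply: H => w' [s /alt_langP[x ->] Hs] S.
  by apply: N; exists x, w'.
case=> x [w' [Hs S]] H; apply: (H w') => //.
by exists (alt_word x l) => //; exact: alt_lang_word.
Qed.

Lemma fsize_diamonds l n : fsize (diamonds l n) = 3 * n + 1.
Proof. by elim: n => [//|n /= ->]; lia. Qed.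

Lemma uses_diamonds (Ls : set language) l n :
  Ls (alt_lang l) -> uses Ls (diamonds l n).
Proof. by move=> H; elim: n. Qed.

Lemma diamonds_true l bs : 0 < l ->
  sat (at_true l ([::], bs)) (diamonds l (size bs).*2).
Proof.
move=> l0; elim: bs => [//|b bs IHbs]; rewrite [size _]/= doubleS.
apply/sat_diamonds; exists (letter_of b).
exists (at_true l (alt_word (iter l.-1 other (letter_of b)) l, bs)); split.
  apply: successor_main; apply/main_path_start => //.
    by case: l l0 {IHbs}.
  exact: main_path_line.
apply/sat_diamonds; exists (iter l.-1 other (letter_of b)).
exists (at_true l ([::], bs)); split=> //.
by apply: successor_main; rewrite -[X in (X, bs)]cats0; exact: main_path_line.
Qed.

(** Detours begin only at the start of a gadget, so within one the sole freedom is to fall. *)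
Lemma successor_inside l f s c bs w : size s <= size c ->
  successor (M := lines l) s (f, (c, bs)) w ->
  exists f',
    [/\ s = take (size s) c, w = (f', (drop (size s) c, bs)) & f' -> f].
Proof.
elim: s f c => [|x s IHs] f c /= sz.
  by move=> <-; exists f; rewrite take0 drop0.
case: c sz => // y c sz /= [[f1 [c1 d1]] /acc_lines e H].
case: e => [[[/= [[ey ec] ed]|[]//] ff]|[[]]//].
rewrite -{}ec -{}ed in H; have [f' [e1 e2 e3]] := IHs _ _ sz H.
by exists f'; split; rewrite -?e1 ?ey // => /e3 /ff.
Qed.

(** Where the flipped prefix of length [k] meets the unflipped rest of the first block, two equal
    letters are adjacent. *)
Lemma alt_word_detour l b k x : 0 < k < l ->
  alt_word x l <> take l (detour l b k).
Proof.
move=> /andP[k0 kl].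
rewrite /detour take_cat size_alt_word ltnNge (ltnW kl) /=.
have -> : take (l - k) (drop k (gadget l b)) =
    alt_word (iter k other (letter_of b)) (l - k).
  rewrite take_drop subnK ?(ltnW kl) // take_gadget //.
  rewrite -[X in alt_word _ X](subnKC (ltnW kl)) alt_wordD drop_size_cat //.
  by rewrite size_alt_word.
rewrite -[X in alt_word _ X](subnKC (ltnW kl)) alt_wordD.
move=> /cat_inj; rewrite !size_alt_word => /(_ erefl)[e1 e2].
have ex := alt_word_inj k0 e1.
have /iter_other_inj : iter k other x = iter k other (letter_of b).
  by apply: alt_word_inj e2; rewrite subn_gt0.
by rewrite ex; exact: other_neq.
Qed.

Lemma diamonds_false l bs : 0 < l ->
  ~ sat (at_false l ([::], bs)) (diamonds l (size bs).*2).
Proof.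
move=> l0; elim: bs => [//|b bs IHbs]; rewrite [size _]/= doubleS.
move=> /sat_diamonds[x [w [Hw /sat_diamonds[x' [w' [Hw' S]]]]]].
(* Once the first diamond ends at the junction on the false line, the second is confined to the last
   block and ends at the false start for [bs]. *)
suff ew : w = at_false l (alt_word (iter l.-1 other (letter_of b)) l, bs).
  move: Hw'; rewrite ew => /successor_inside[|f' [_ ew' ff]].
    by rewrite !size_alt_word.
  apply: IHbs; move: S.
  rewrite ew' size_alt_word drop_oversize ?size_alt_word //.
  by case: f' ff {ew'} => // /(_ isT).
have : exists s, s = alt_word x l by exists (alt_word x l).
case=> s es; have sz : size s = l by rewrite es size_alt_word.
move: Hw; rewrite -es; case: s es sz => [|y s] es sz.
  by rewrite -sz in l0.
move=> /= [[f [c d]] /acc_lines e H].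
case: e => [[[[]//|[_ [b' [eb ed] eg]]] ff]|[[_ [b' [k [[eb ed] kl eg]]]] _]].
  rewrite /= -eb in eg; rewrite /= in ed.
  have ff' : f = false by case: (f) ff => // /(_ isT).
  rewrite -ed ff' in H.
  have szc : size s <= size c.
    by have := size_gadget l b; rewrite eg /=; move: sz => /=; lia.
  have [f' [_ -> {}ff]] := successor_inside szc H.
  have -> : f' = false by case: f' ff => // /(_ isT).
  congr (_, (_, _)).
  have -> : drop (size s) c = drop l (gadget l b) by rewrite eg -sz.
  by rewrite /gadget drop_size_cat // size_alt_word.
(* After entering a detour, the [l] letters read would be its first [l] ones, which do not
   alternate. *)
exfalso; apply: (alt_word_detour (b := b) (x := x) kl).
rewrite eb eg -es -sz /=.
have szc : size s <= size c.
  have : size (detour l b' k) = l + l.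
    by rewrite size_cat size_alt_word size_drop size_gadget; lia.
  by rewrite eg /=; move: sz => /=; lia.
by have [f' [<-]] := successor_inside szc H.
Qed.

Lemma separates_diamonds l bs : 0 < l ->
  separates l (diamonds l (size bs).*2) ([::], bs).
Proof.
by move=> l0 [H _]; exact: (diamonds_false l0 (H (diamonds_true bs l0))).
Qed.

Lemma separates_equivalent l phi psi q :
  equivalent phi psi -> separates l phi q -> separates l psi q.
Proof. by move=> E H [H1 H2]; apply: H; split=> /E ?; apply/E; auto. Qed.

(** * Equal expressivity *)

Fixpoint boxes (s : word) (phi : formula) : formula :=
  if s is x :: s' then Box (fun u => u = [:: x]) (boxes s' phi) else phi.

Lemma sat_boxes (M : model) (w : world M) s phi :
  sat w (boxes s phi) <-> forall w', successor s w w' -> sat w' phi.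
Proof.
elim: s w => [|x s IHs] w /=; first by split=> [H _ <-|]; auto.
split=> H.
  move=> w' [v a Hs]; apply: (iffLR (IHs v)) Hs; apply: H.
  by exists [:: x] => //=; exists v.
move=> v [_ -> /= [v' a ev]]; apply/IHs => w' Hs.
by apply: H; exists v' => //; rewrite ev.
Qed.

Local Open Scope classical_set_scope.

(** [[A_k]] is the conjunction of the boxes for its two words, each a chain of one-letter boxes,
    available for every [J]. *)
Lemma logicA_plus_expressible (I J : set nat) phi : logicA_plus I phi ->
  exists2 psi, logicA_plus J psi & equivalent phi psi.
Proof.
rewrite /logicA_plus /logic /=.
elim: phi => [n|phi IH|phi IH psi IH'|L phi IH] /=.
- by move=> _; exists (Var n).
- move=> /IH[phi' U E]; exists (Neg phi') => //= M w /=.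
  by split=> H /E; exact: H.
- move=> [/IH[phi' U E] /IH'[psi' U' E']]; exists (Or phi' psi') => //= M w /=.
  by split=> -[/E|/E'] H; auto.
- move=> [UL /IH[phi' U E]].
  case: UL => [[k Ik <-]|UL]; last first.
    exists (Box L phi') => [|M w /=]; first by split=> //; right.
    by split=> H w' /H /E.
  pose conj a b := Neg (Or (Neg a) (Neg b)).
  exists (conj (boxes (alt_word L1 k) phi') (boxes (alt_word L2 k) phi')).
    rewrite /=; split; [elim: (alt_word L1 k) | elim: (alt_word L2 k)] => //=;
      by move=> x s IHs; split=> //; right; case: x; [left | right].
  move=> M w /=; split=> H.
    case; apply; apply/sat_boxes => w' Hs; apply/E; apply: H.
      by exists (alt_word L1 k) => //; left.
    by exists (alt_word L2 k) => //; right.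
  move=> w' [s Ls Hs]; apply/E; apply: contrapT => N; apply: H.
  by case: Ls Hs => -> Hs; [left | right] => /sat_boxes /(_ _ Hs).
Qed.

(** * Succinctness and inexpressibility *)

Theorem theorem7 (I1 I2 : set nat)
    (hI1 : forall l, I1 l -> 0 < l) (hI2 : forall l, I2 l -> 0 < l)
    (hI : ~ (I1 `<=` I2)) :
  exponentially_more_succinct (logicA_plus I1) (logicA_plus I2) /\
  (exists2 phi, logicA I1 phi &
     ~ (exists2 psi, logicA I2 psi & equivalent phi psi)).
Proof.
have [l [I1l I2l]] : exists l, I1 l /\ ~ I2 l.
  by move/existsNP: hI => [l /not_implyP]; exists l.
have l0 := hI1 _ I1l.
split; last first.
  (* A single gadget suffices, hence two diamonds. *)
  exists (diamonds l 2); first by apply: uses_diamonds; exists l.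
  move=> [psi Upsi E].
  apply: (@not_separating l I2 psi true [::] l0 I2l hI2 Upsi).
  apply: separates_equivalent E _.
  exact: (separates_diamonds (bs := [:: true]) l0).
split; first by split=> phi; exact: logicA_plus_expressible.
exists (fun i => diamonds l i.*2); split.
- by move=> i; apply: uses_diamonds; left; exists l.
(* Each bit costs two diamonds of size 3. *)
- by exists 6, 1 => i; rewrite fsize_diamonds; lia.
- exists 2%:R%R; first by rewrite ltr1n.
  move=> i psi Upsi E; rewrite -natrX ler_nat.
  have <- : #|[set: i.-tuple bool]%SET| = 2 ^ i.
    by rewrite cardsT card_tuple card_bool.
  (* Before anything is read, all [2 ^ i] sequences share the empty word. *)
  apply: (separating_size (v := [::]) l0 I2l hI2 Upsi) => bs _.
  exists ([::], val bs) => //.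
  apply: separates_equivalent (_ : equivalent (diamonds l i.*2) psi) _.
    by move=> M w; rewrite (E M w).
  by have := separates_diamonds (bs := val bs) l0; rewrite size_tuple.
Qed.
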